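(* Let $q$ be an odd prime power, $n$ a positive integer, and $f(x,y,z,t)=xy+z+t$ viewed as a function from $M_n(\mathbb{F}_q)^4$ to $M_n(\mathbb{F}_q)$. There is a constant $C_0>0$ (independent of $q$ and $A$) such that for every $A\subset M_n(\mathbb{F}_q)$ with $|A|\ge C_0\, q^{n^2-1/4}$ we have $f(A,A,A,A)=M_n(\mathbb{F}_q)$, i.e. every matrix $M\in M_n(\mathbb{F}_q)$ can be written as $a_1a_2+a_3+a_4$ with $a_1,a_2,a_3,a_4\in A$.
   Context: $M_n(\mathbb{F}_q)$ is the ring of $n\times n$ matrices over $\mathbb{F}_q$. *)

(* Defs.v *)
From HB Require Import structures.
From mathcomp Require Import all_boot all_order all_algebra.
From mathcomp Require Import reals exp.

Set Implicit Arguments.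
Unset Strict Implicit.
Unset Printing Implicit Defensive.

Import Order.TTheory GRing.Theory Num.Theory.
Local Open Scope ring_scope.

Definition mx_xy_z_t (F : finFieldType) (n : nat) (x y z t : 'M[F]_n) : 'M[F]_n :=
  x *m y + z + t.

Definition image4 (T U : finType) (f : T -> T -> T -> T -> U)
    (A B C D : {set T}) : {set U} :=
  [set u | [exists x in A, exists y in B, exists z in C, exists t in D,
             u == f x y z t]].

(* Main.v *)
(* Fix M, put N = #|M_n(F)|, a = #|A|, and let d(y, t) count the x in A with
   M - t - x y in A.  Over all pairs (y, t) the mean of d is a^2 / N.  Its second
   moment counts solutions of x y + z = x' y + z': when x - x' is invertible the
   pair (z, y) behaves as if equidistributed and contributes exactly a^2, and
   otherwise at most N a.  Hence the variance is controlled by the number s of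
   singular matrices.  If M is not represented then d vanishes on A * A, which
   forces a^4 <= N^3 s; since s <= n N / q, this gives a^4 <= n N^4 / q. *)

Require Import Defs.
From HB Require Import structures.
From mathcomp Require Import all_boot all_order all_algebra.
From mathcomp Require Import reals exp.
From mathcomp Require Import ring zify.

Set Implicit Arguments.
Unset Strict Implicit.
Unset Printing Implicit Defensive.

Import Order.TTheory GRing.Theory Num.Theory.
Local Open Scope ring_scope.

Section FiniteRing.
Variables (T : finUnitRingType) (A : {set T}).

Let ind (z : T) : int := (z \in A)%:R.
Let a : int := #|A|%:R.
Let N : int := #|T|%:R.
Let s : int := #|[pred u : T | u \isn't a GRing.unit]|%:R.

Lemma sum_indicator : \sum_z ind z = a.
Proof.
rewrite /a -sum1_card natr_sum [RHS]big_mkcond; apply: eq_bigr => z _.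
by rewrite /ind; case: (z \in A).
Qed.

Lemma sum_indicator_bij (h : T -> T) : injective h -> \sum_z ind (h z) = a.
Proof. by move=> h_inj; rewrite -sum_indicator [RHS](reindex_inj h_inj). Qed.

Lemma sum_const_full (c : int) : \sum_(y : T) c = N * c.
Proof. by rewrite sumr_const mulr_natl. Qed.

Lemma sum_const_in (c : int) : \sum_(x in A) c = a * c.
Proof. by rewrite sumr_const mulr_natl. Qed.

Lemma ind_ge0 z : 0 <= ind z.
Proof. exact: ler0n. Qed.

(** If [u] is a unit, then for each fixed [z] the map [y] to [z + u * y] permutes the ring, so the
    two indicators decouple. Otherwise the second indicator is simply bounded by 1. *)
Lemma pair_correlation_le (u : T) :
  \sum_y \sum_z ind z * ind (z + u * y) <=
    a ^+ 2 + (u \isn't a GRing.unit)%:R * (N * a).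
Proof.
have [uU|uNU] /= := boolP (u \is a GRing.unit).
  rewrite mul0r addr0 exchange_big /=.
  under eq_bigr => z _.
    rewrite -mulr_sumr (@sum_indicator_bij (fun y => z + u * y)); last first.
      by move=> y y' /addrI /(mulrI uU).
    over.
  by rewrite -mulr_suml sum_indicator expr2.
rewrite mul1r; apply: (@le_trans _ _ (N * a)); last by rewrite lerDr sqr_ge0.
rewrite -(sum_const_full a); apply: ler_sum => y _.
rewrite -sum_indicator; apply: ler_sum => z _.
by rewrite ler_piMr ?ind_ge0 // /ind lern1 leq_b1.
Qed.

Variable M : T.

Let d (y t : T) : int := \sum_(x in A) ind (M - t - x * y).

Lemma first_moment : \sum_y \sum_t d y t = N * a ^+ 2.
Proof.
rewrite expr2 -sum_const_full; apply: eq_bigr => y _.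
rewrite /d exchange_big /= -sum_const_in; apply: eq_bigr => x _.
by apply: sum_indicator_bij => t t' /addIr /addrI /oppr_inj.
Qed.

Lemma second_moment_le :
  \sum_y \sum_t d y t ^+ 2 <= a ^+ 4 + a ^+ 2 * N * s.
Proof.
have -> : \sum_y \sum_t d y t ^+ 2 =
    \sum_(x in A) \sum_(x' in A) \sum_y \sum_z ind z * ind (z + (x - x') * y).
  under eq_bigr => y _ do under eq_bigr => t _ do
    rewrite expr2 {1}/d mulr_suml.
  under eq_bigr => y _ do rewrite exchange_big /=.
  rewrite exchange_big /=; apply: eq_bigr => x _.
  under eq_bigr => y _ do under eq_bigr => t _ do rewrite /d mulr_sumr.
  under eq_bigr => y _ do rewrite exchange_big /=.
  rewrite exchange_big /=; apply: eq_bigr => x' _; apply: eq_bigr => y _.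
  (* Substituting [z = M - t - x * y] turns [M - t - x' * y] into [z + (x - x') * y]. *)
  rewrite [RHS](reindex_inj (h := fun t => M - t - x * y)) /=; last first.
    by move=> t t' /addIr /addrI /oppr_inj.
  by apply: eq_bigr => t _; rewrite mulrBl addrA subrK.
have -> : a ^+ 4 + a ^+ 2 * N * s =
    \sum_(x in A) (a * a ^+ 2 + s * (N * a)).
  by rewrite sum_const_in; ring.
apply: ler_sum => x _.
apply: le_trans (_ : \sum_(x' in A)
    (a ^+ 2 + (x - x' \isn't a GRing.unit)%:R * (N * a)) <= _).
  by apply: ler_sum => x' _; apply: pair_correlation_le.
rewrite big_split /= sum_const_in lerD2l -mulr_suml ler_wpM2r //.
  by rewrite mulr_ge0 ?ler0n.
rewrite /s -sum1_card natr_sum [leRHS]big_mkcond [leLHS]big_mkcond /=.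
(* For fixed [x], distinct [x'] give distinct differences, so at most [s] of them are singular. *)
have xB_inj : injective (fun x' => x - x') by move=> y y' /addrI /oppr_inj.
rewrite [leRHS](reindex_inj xB_inj) /=; apply: ler_sum => x' _.
by rewrite inE; case: (x' \in A) => //; case: (_ \is a _).
Qed.

Lemma not_representable_bound :
    (forall x y z t, x \in A -> y \in A -> z \in A -> t \in A ->
       x * y + z + t != M) ->
  (#|A| ^ 4 <= #|T| ^ 3 * #|[pred u : T | u \isn't a GRing.unit]|)%N.
Proof.
move=> notM.
have d0 y t : y \in A -> t \in A -> d y t = 0.
  move=> yA tA; rewrite /d big1 // => x xA; rewrite /ind.
  case zA: (_ \in A) => //; case/negP: (notM _ _ _ _ xA yA zA tA).
  by rewrite [x * y + _]addrC !subrK eqxx.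
have [A0|A_gt0] := posnP #|A|; first by rewrite A0.
(* Deviations from the mean are scaled by [N] to stay in the integers. Each of the [a ^+ 2] pairs in
   [A * A] has [d = 0] and contributes [a ^+ 4]. *)
have var_ge : a ^+ 6 <= \sum_y \sum_t (N * d y t - a ^+ 2) ^+ 2.
  have -> : a ^+ 6 = \sum_(y in A) \sum_(t in A) (N * d y t - a ^+ 2) ^+ 2.
    under eq_bigr => y yA do under eq_bigr => t tA do
      rewrite (d0 y t yA tA) mulr0 sub0r sqrrN.
    by rewrite !sum_const_in; ring.
  rewrite [leLHS]big_mkcond; apply: ler_sum => y _.
  case: ifP => _; last by apply: sumr_ge0 => t _; apply: sqr_ge0.
  rewrite [leLHS]big_mkcond; apply: ler_sum => t _.
  by case: ifP => // _; apply: sqr_ge0.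
have varE : \sum_y \sum_t (N * d y t - a ^+ 2) ^+ 2 =
    N ^+ 2 * (\sum_y \sum_t d y t ^+ 2) - N ^+ 2 * a ^+ 4.
  transitivity (\sum_y \sum_t
      (N ^+ 2 * d y t ^+ 2 + (- (2 * N * a ^+ 2) * d y t + a ^+ 4))).
    by apply: eq_bigr => y _; apply: eq_bigr => t _; ring.
  under eq_bigr => y _ do rewrite !big_split /= -!mulr_sumr sum_const_full.
  by rewrite !big_split /= -!mulr_sumr sum_const_full first_moment; ring.
have N2_ge0 : 0 <= N ^+ 2 by apply: sqr_ge0.
(* The main term [a ^+ 4] of the second moment cancels against the squared mean; only the singular
   contribution survives. *)
have le6 : a ^+ 6 <= N ^+ 2 * (a ^+ 2 * N * s).
  apply: le_trans var_ge _; rewrite varE -mulrBr ler_wpM2l //.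
  by rewrite lerBlDl second_moment_le.
have a2_gt0 : 0 < a ^+ 2 by rewrite exprn_gt0 // ltr0n.
have : a ^+ 2 * a ^+ 4 <= a ^+ 2 * (N ^+ 3 * s).
  by rewrite -exprD (_ : _ * _ = N ^+ 2 * (a ^+ 2 * N * s)) //; ring.
by rewrite ler_pM2l // -!natrX -natrM ler_nat.
Qed.

End FiniteRing.

(** The exponent is [1 + ... + n]. This crude bound controls the loss in the inductive step of the
    lower bound that follows. *)
Lemma prod_expn_sub1_le (q n : nat) : (0 < q)%N ->
  (\prod_(1 <= i < n.+1) (q ^ i - 1) <= q ^ 'C(n.+1, 2))%N.
Proof.
move=> q_gt0; elim: n => [|n IHn]; first by rewrite big_geq.
by rewrite big_nat_recr //= binS bin1 expnD leq_mul ?leq_subr.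
Qed.

(* The union bound [1 - prod_i (1 - q ^ -i) <= n / q], cleared of denominators. *)
Lemma prod_expn_sub1_ge (q n : nat) : (0 < q)%N ->
  (q * q ^ 'C(n.+1, 2) <=
     q * \prod_(1 <= i < n.+1) (q ^ i - 1) + n * q ^ 'C(n.+1, 2))%N.
Proof.
move=> q_gt0; elim: n => [|n IHn].
  by rewrite big_geq // bin_small // addn0.
rewrite big_nat_recr //= (binS n.+1) bin1 expnD.
have := prod_expn_sub1_le n q_gt0.
move: (\prod_(_ <= _ < _) _)%N ('C(n.+1, 2)) IHn => P k IHn leP.
(* Replacing the factor [q ^ n.+1] by [q ^ n.+1 - 1] loses [q * P], which the extra unit in the
   coefficient [n.+1] pays for. *)
have leqP : (q * P <= q ^ k * q ^ n.+1)%N.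
  by rewrite mulnC leq_mul // -[leqLHS]expn1 leq_pexp2l.
have := leq_mul IHn (leqnn (q ^ n.+1)).
rewrite !mulnBr muln1.
move: (q ^ k)%N (q ^ n.+1)%N leqP => Q X leqP; nia.
Qed.

(** Follows from the order formula for the general linear group and the product bound above. *)
Lemma card_nonunit_mx_le (F : finFieldType) (n : nat) :
  (#|F| * #|[pred u : 'M[F]_n.+1 | u \isn't a GRing.unit]| <=
     n.+1 * #|{: 'M[F]_n.+1}|)%N.
Proof.
set U := [pred u : 'M[F]_n.+1 | u \is a GRing.unit].
have cardU : (#|U| + #|[pred u : 'M[F]_n.+1 | u \isn't a GRing.unit]| =
    #|{: 'M[F]_n.+1}|)%N.
  by rewrite -(cardC U); congr addn; apply: eq_card.
have defU : #|U| = (#|F| ^ 'C(n.+1, 2) *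
    \prod_(1 <= i < n.+2) (#|F| ^ i - 1))%N.
  by rewrite -card_GL // cardsT card_sub; apply: eq_card.
have q_gt0 : (0 < #|F|)%N by apply/card_gt0P; exists 0.
have := leq_mul (leqnn (#|F| ^ 'C(n.+1, 2))) (prod_expn_sub1_ge n.+1 q_gt0).
(* A square is the sum of two consecutive triangular numbers. *)
have cardM : #|{: 'M[F]_n.+1}| = (#|F| ^ 'C(n.+1, 2) * #|F| ^ 'C(n.+2, 2))%N.
  rewrite card_mx -expnD; congr (_ ^ _)%N.
  rewrite (binS n.+1) bin1.
  have := bin_ffact n.+1 2; rewrite !ffactSS ffactn1 (_ : 2`! = 2)%N //; lia.
move: defU cardM; move: ('C(_, _)) ('C(_, _)) (\prod_(_ <= _ < _) _)%N => k l P.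
by move: cardU; nia.
Qed.

Theorem theorem1p11 (R : realType) (n : nat) (n_gt0 : (0 < n)%N) :
  exists2 C0 : R, 0 < C0 &
    forall (F : finFieldType) (q : nat), #|F| = q -> odd q ->
    forall A : {set 'M[F]_n},
      C0 * q%:R `^ ((n ^ 2)%N%:R - 1 / 4%:R) <= #|A|%:R ->
      image4 (@mx_xy_z_t F n) A A A A = [set: 'M[F]_n].
Proof.
(* The matrix size is now [n.+1]; any constant whose fourth power exceeds [n.+1] would do. *)
case: n n_gt0 => // n _; exists n.+2%:R; first by rewrite ltr0n.
move=> F q cardF _ A leA; apply/setP => M; rewrite [RHS]inE.
apply: contraTT leA => Mnot; rewrite -ltNge.
have /not_representable_bound leA4 : forall x y z t,
    x \in A -> y \in A -> z \in A -> t \in A -> x * y + z + t != M.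
  move=> x y z t xA yA zA tA; apply: contra Mnot => /eqP defM.
  rewrite inE; apply/existsP; exists x; rewrite xA /=.
  apply/existsP; exists y; rewrite yA /=; apply/existsP; exists z; rewrite zA /=.
  by apply/existsP; exists t; rewrite tA /= -defM /mx_xy_z_t mulmxE.
have q_gt0 : (0 < q)%N by rewrite -cardF; apply/card_gt0P; exists 0.
have leqA : (q * #|A| ^ 4 <= n.+1 * #|{: 'M[F]_n.+1}| ^ 4)%N.
  apply: leq_trans (leq_mul (leqnn q) leA4) _.
  rewrite mulnCA -{1}cardF [X in (_ <= X)%N](_ : _ =
    #|{: 'M[F]_n.+1}| ^ 3 * (n.+1 * #|{: 'M[F]_n.+1}|))%N; last first.
    by rewrite mulnCA -expnSr.
  by rewrite leq_mul2l card_nonunit_mx_le orbT.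
rewrite card_mx cardF mulnn in leqA.
have qR_gt0 : 0 < q%:R :> R by rewrite ltr0n.
set p := q%:R `^ _.
have p_gt0 : 0 < p by apply: powR_gt0.
(* The [1/4] in the exponent is what makes [q * p ^+ 4] equal to the fourth power of the number of
   matrices, so comparing fourth powers leaves only [n.+1 < n.+2 ^ 4]. *)
have p4 : q%:R * p ^+ 4 = (q%:R ^+ (n.+1 ^ 2)) ^+ 4 :> R.
  rewrite /p -(powR_mulrn 4) ?ltW // -powRrM mulrBl mul1r mulVf ?pnatr_eq0 //.
  rewrite powRB ?(gt_eqF qR_gt0) ?implybT // powRr1 ?ltW //.
  by rewrite mulrC divfK ?gt_eqF // -natrM powR_mulrn ?ltW // exprM.
rewrite -(@ltr_pXn2r _ 4) ?nnegrE ?ler0n ?mulr_ge0 ?ltW //.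
rewrite -(ltr_pM2l qR_gt0) exprMn [ltRHS]mulrCA p4 -!natrX -!natrM.
rewrite ltr_nat; apply: leq_ltn_trans leqA _.
by rewrite ltn_pmul2r ?expn_gt0 ?q_gt0 // -[leqLHS]expn1 leq_pexp2l.
Qed.
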